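(* A maximally non-hamiltonian graph of order $n$ cannot have maximum degree $n-2$ or $n-3$.
   Context: Graphs are finite and simple, with at least three vertices. A graph is hamiltonian if it contains a spanning cycle. A graph $G$ is maximally non-hamiltonian if $G$ is non-hamiltonian and for every pair of (distinct) non-adjacent vertices $v$ and $w$, the graph $G$ contains a hamiltonian path (spanning path) between $v$ and $w$. The order of a graph is its number of vertices. *)

(* Defs.v *)
From mathcomp Require Export all_boot.

Set Implicit Arguments.
Unset Strict Implicit.
Unset Printing Implicit Defensive.

(* A finite graph is given by its adjacency relation on a finite vertex type. *)
Definition simple_graph (T : finType) (e : rel T) : Prop :=
  symmetric e /\ irreflexive e.

(* The bound on the size excludes the degenerate closed walks [::], [:: x] and
   [:: x; y], which [ucycle] alone would accept. *)
Definition hamiltonian (T : finType) (e : rel T) : Prop :=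
  exists c : seq T, [/\ 2 < size c, ucycle e c & forall x, x \in c].

Definition hamiltonian_path (T : finType) (e : rel T) (v w : T) : Prop :=
  exists p : seq T,
    [/\ path e v p, last v p = w, uniq (v :: p) & forall x, x \in v :: p].

Definition maximally_non_hamiltonian (T : finType) (e : rel T) : Prop :=
  ~ hamiltonian e /\
  forall v w : T, v != w -> ~~ e v w -> hamiltonian_path e v w.

Definition degree (T : finType) (e : rel T) (v : T) : nat := #|[set u | e v u]|.

Definition max_degree (T : finType) (e : rel T) : nat := \max_(v : T) degree e v.

(* Main.v *)
Require Import Defs.

Set Implicit Arguments.
Unset Strict Implicit.
Unset Printing Implicit Defensive.

(** Let [v] have maximum degree [d < n - 1] and let [w] be another vertex not
adjacent to [v]. Walking along a hamiltonian path from [v] to [w], the successor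
of a neighbour of [w] is never adjacent to [v] (otherwise the path could be
rerouted into a hamiltonian cycle), so the successor map injects the neighbours
of [w] into the [n - 1 - d] vertices other than [v] not adjacent to [v].
For [d = n - 2] this gives a vertex of degree at most 1. For [d = n - 3] the two
non-neighbours [w1], [w2] of [v] have degree at most 2, and if [w1] has degree 2,
the injection is onto, so some neighbour of [w1] precedes [w2] and is adjacent to
both. No such configuration exists when every vertex [x] has a non-neighbour [z]:
on a hamiltonian path from [x] to [z], a neighbour of [x] of degree at most 2 has
degree exactly 2 and has to come right after [x]. *)

Definition nonneighbours (T : finType) (e : rel T) (v : T) : {set T} :=
  [set u | (u != v) && ~~ e v u].

Lemma card_nonneighbours (T : finType) (e : rel T) (v : T) :
  irreflexive e -> degree e v + #|nonneighbours e v| = #|T|.-1.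
Proof.
move=> irr; rewrite -(cardsC1 v) /degree.
rewrite -(cardsID [set u | e v u] [set~ v]); congr (_ + _); apply: eq_card => u.
  rewrite !inE; case: eqP => [->|_]; first by rewrite irr.
  by case: (e v u).
by rewrite !inE andbC.
Qed.

Lemma next_spanning_path_nonneighbour (T : finType) (e : rel T) (v u : T)
    (p : seq T) :
    symmetric e -> 2 < #|T| -> ~ hamiltonian e ->
    path e v p -> uniq (v :: p) -> (forall x, x \in v :: p) ->
    e (last v p) u -> u != last v p ->
  next (v :: p) u \in nonneighbours e v /\ e u (next (v :: p) u).
Proof.
move=> sym T3 nham vp Up allp wu uNw.
have [q1 [q2 E]] : exists q1 q2, v :: p = rcons q1 u ++ q2.
  by case/path.splitP: (allp u) => q1 q2; exists q1, q2.
(* Since [u] is not the end of the path, it has a true successor [b] there, and the cyclic [next]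
   does not wrap around. *)
case: q2 E => [|b q2] E.
  by move: uNw; rewrite -[last v p]/(last v (v :: p)) E cats0 last_rcons eqxx.
have sE : v :: p = q1 ++ [:: u, b & q2] by rewrite E cat_rcons.
have nb : next (v :: p) u = b.
  by rewrite -(next_rot (size q1) Up) sE rot_size_cat /= eqxx.
have lE : last v p = last b q2.
  by rewrite -[last v p]/(last v (v :: p)) sE last_cat.
have bNv : b != v.
  apply: contraTneq Up => bv; case: q1 {E} sE => [|a q1] [_ ->].
    by rewrite -bv /= inE eqxx.
  by rewrite -bv /= mem_cat !inE eqxx !orbT.
have [ub pe] : e u b /\ path e b q2.
  move: vp; rewrite -[path e v p]/(sorted e (v :: p)) sE.
  by move=> /cat_sorted2[_ /= /andP[]].
rewrite nb inE bNv; split=> //; apply/negP => vb; apply: nham.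
(* The rerouted cycle: follow the path from [v] to [u], jump to its end, walk back to [b], and close
   with the edge [b v]. *)
exists (rcons q1 u ++ rev (b :: q2)).
have pm : perm_eq (v :: p) (rcons q1 u ++ rev (b :: q2)).
  by rewrite E perm_cat2l perm_sym perm_rev.
split; last by move=> x; rewrite -(perm_mem pm).
  rewrite -(perm_size pm); apply: leq_trans T3 _.
  rewrite -(card_uniqP Up); apply/subset_leq_card/subsetP => x _; exact: allp.
rewrite /ucycle -(perm_uniq pm) Up andbT.
have s1 : sorted e (rcons q1 u).
  by move: vp; rewrite -[path e v p]/(sorted e (v :: p)) E => /cat_sorted2[].
have [q qE] : exists q, rcons q1 u = v :: q.
  case: q1 sE {E pm s1} => [|a q1] [-> _] /=; first by exists [::].
  by exists (rcons q1 u).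
move: s1; rewrite qE => s1.
have lq : last v q = u by rewrite -[last v q]/(last v (v :: q)) -qE last_rcons.
rewrite cat_cons /= rcons_path cat_path last_cat rev_cons last_rcons.
rewrite (sym b) vb andbT; apply/andP; split; first exact: s1.
rewrite lq -rev_cons.
have -> : rev (b :: q2) = last b q2 :: rev (belast b q2).
  by rewrite lastI rev_rcons.
rewrite /= -lE sym wu /= lE.
by rewrite rev_path (eq_path (e' := e)) // => x y; rewrite sym.
Qed.

(** Taking the cyclic [next] of the whole spanning path makes the successor map injective on all of
    [T], with inverse [prev]. *)
Lemma neighbour_injection (T : finType) (e : rel T) (v w : T) :
    simple_graph e -> 2 < #|T| -> ~ hamiltonian e -> hamiltonian_path e v w ->
  exists f : T -> T,
    [/\ injective f,
        f @: [set u | e w u] \subset nonneighbours e v &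
        forall u, e w u -> e u (f u)].
Proof.
move=> [sym irr] T3 nham [p [vp <- Up allp]].
have key u : e (last v p) u -> next (v :: p) u \in nonneighbours e v
    /\ e u (next (v :: p) u).
  move=> wu; apply: next_spanning_path_nonneighbour => //.
  by apply: contraTneq wu => ->; rewrite irr.
exists (next (v :: p)); split.
- exact: can_inj (prev_next Up).
- by apply/subsetP => _ /imsetP[u + ->]; rewrite inE => /key[].
- by move=> u /key[].
Qed.

(** Not being last, [w] has a successor [b] on the path. If its predecessor [c] were not [x], then
    [x], [c] and [b] would be three distinct neighbours of [w]; otherwise [x] and [b] already give
    degree 2. *)
Lemma degree_le2_second (T : finType) (e : rel T) (x w : T) (p : seq T) :
    symmetric e -> path e x p -> uniq (x :: p) -> w \in p -> w != last x p ->
    e x w -> degree e w <= 2 ->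
  head x p = w /\ degree e w = 2.
Proof.
move=> sym + + wp; case/splitPr: wp => p1 [|b q].
  by rewrite last_cat /= eqxx.
move=> + + _ xw dw.
rewrite cat_path /= => /and4P[_ aw wb _] /andP[xNp Up1].
have xNb : x != b.
  by apply: contraNneq xNp => ->; rewrite mem_cat !inE eqxx !orbT.
case: p1 aw xNp Up1 => [|a p1] aw xNp Up1.
  split=> //; apply/eqP; rewrite eqn_leq dw /=.
  have <- : #|[set x; b]| = 2 by rewrite cards2 xNb.
  apply/subset_leq_card/subsetP => y; rewrite !inE => /orP[]/eqP-> //.
  by rewrite sym.
set c := last x (a :: p1) in aw.
have cp : c \in a :: p1 by rewrite /c /= mem_last.
have xNc : x != c by apply: contraNneq xNp => ->; rewrite mem_cat cp.
have cNb : c != b.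
  apply: contraTneq Up1 => cb; rewrite cat_uniq negb_and; apply/orP.
  right; rewrite negb_and negbK; apply/orP; left; apply/hasP; exists c => //.
  by rewrite cb !inE eqxx orbT.
suff : 2 < degree e w by rewrite ltnNge dw.
have <- : #|x |: [set c; b]| = 3.
  by rewrite cardsU1 cards2 cNb !inE (negPf xNc) (negPf xNb).
apply/subset_leq_card/subsetP => y; rewrite !inE => /or3P[]/eqP-> //.
  by rewrite sym.
by rewrite sym.
Qed.

Lemma low_degree_neighbour_second (T : finType) (e : rel T) (x : T) :
    simple_graph e -> maximally_non_hamiltonian e -> degree e x < #|T|.-1 ->
  exists s : T, forall w, e x w -> degree e w <= 2 -> s = w /\ degree e w = 2.
Proof.
move=> [sym irr] [_ mnh] dx.
have /card_gt0P[z] : 0 < #|nonneighbours e x|.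
  by rewrite -(ltn_add2l (degree e x)) addn0 card_nonneighbours.
rewrite inE eq_sym => /andP[xNz nxz].
have [p [xp lz Up allp]] := mnh _ _ xNz nxz.
(* The path to [z] is fixed before [w] is chosen, so one second vertex serves every [w]. A neighbour
   of [x] cannot be the last vertex [z]. *)
exists (head x p) => w xw; apply: degree_le2_second => //.
  have := allp w; rewrite inE => /orP[/eqP wx|//].
  by move: xw; rewrite wx irr.
by rewrite lz; apply: contraNneq nxz => <-.
Qed.

Lemma degree_nonneighbour (T : finType) (e : rel T) (v w : T) :
    simple_graph e -> 2 < #|T| -> maximally_non_hamiltonian e ->
    w \in nonneighbours e v ->
  degree e w <= #|nonneighbours e v|.
Proof.
move=> G T3 [nham mnh]; rewrite inE eq_sym => /andP[vw nvw].
have [f [fI fS _]] := neighbour_injection G T3 nham (mnh _ _ vw nvw).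
by rewrite /degree -(card_imset _ fI) subset_leq_card.
Qed.

Lemma degree_gt0 (T : finType) (e : rel T) (w : T) :
    symmetric e -> 1 < #|T| -> maximally_non_hamiltonian e -> 0 < degree e w.
Proof.
move=> sym T2 [_ mnh].
have /card_gt0P[y] : 0 < #|[set~ w]| by rewrite cardsC1 -ltnS prednK // ltnW.
rewrite !inE eq_sym => wy; apply/card_gt0P.
have [wEy|nwy] := boolP (e w y); first by exists y; rewrite inE.
have [[|a p] [/= wp l _ _]] := mnh _ _ wy nwy; first by rewrite l eqxx in wy.
by exists a; rewrite inE; case/andP: wp.
Qed.

Lemma max_degree_attained (T : finType) (e : rel T) :
  0 < #|T| -> exists v, degree e v = max_degree e.
Proof. by move=> T0; have [v] := eq_bigmax (degree e) T0; exists v. Qed.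

(** A vertex of degree at most 1 has a neighbour [x], and seen from [x] its degree would have to be
    exactly 2. *)
Lemma mnh_degree_ge2 (T : finType) (e : rel T) (w : T) :
    simple_graph e -> 2 < #|T| -> maximally_non_hamiltonian e ->
    max_degree e < #|T|.-1 ->
  1 < degree e w.
Proof.
move=> G T3 mnh dmax; have [sym irr] := G.
have := degree_gt0 w sym (ltnW T3) mnh; case/card_gt0P=> x; rewrite inE => wx.
have [s sP] := low_degree_neighbour_second G mnh
  (leq_ltn_trans (leq_bigmax x) dmax).
rewrite ltnNge; apply/negP => dw.
have [] := sP w _ (leqW dw); first by rewrite sym.
by move=> _ d2; rewrite d2 in dw.
Qed.

(** Both vertices must be the second vertex of the same path from [x]. *)
Lemma mnh_degree2_common_neighbour (T : finType) (e : rel T) (x w1 w2 : T) :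
    simple_graph e -> maximally_non_hamiltonian e ->
    max_degree e < #|T|.-1 -> e x w1 -> e x w2 ->
    degree e w1 <= 2 -> degree e w2 <= 2 ->
  w1 = w2.
Proof.
move=> G mnh dmax xw1 xw2 d1 d2.
have [s sP] := low_degree_neighbour_second G mnh
  (leq_ltn_trans (leq_bigmax x) dmax).
by have [<- _] := sP _ xw1 d1; have [<- _] := sP _ xw2 d2.
Qed.

Theorem corollary12 (T : finType) (e : rel T) (n : nat)
  (hT : #|T| = n) (hn : 3 <= n)
  (hG : simple_graph e) (hmnh : maximally_non_hamiltonian e) :
  max_degree e <> n - 2 /\ max_degree e <> n - 3.
Proof.
subst n; have [sym irr] := hG.
have T0 : 0 < #|T| by exact: leq_trans hn.
have [v dv] := max_degree_attained e T0.
have := card_nonneighbours v irr; rewrite dv => cN.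
split=> dE; rewrite dE in cN.
  have dmax : max_degree e < #|T|.-1 by rewrite dE; case: #|T| hn => [|[|[]]].
  have N1 : #|nonneighbours e v| = 1.
    by apply: (@addnI (#|T| - 2)); rewrite cN; case: #|T| hn => [|[|[|k]]] // _;
       rewrite !subSS subn0 addn1.
  have /card_gt0P[w wN] : 0 < #|nonneighbours e v| by rewrite N1.
  (* The single non-neighbour [w] of [v] would have degree at most 1, against the lower bound 2. *)
  have := degree_nonneighbour hG hn hmnh wN.
  by rewrite N1 leqNgt (mnh_degree_ge2 w hG hn hmnh dmax).
have dmax : max_degree e < #|T|.-1.
  by rewrite dE; case: #|T| hn => [|[|[|k]]] // _; rewrite !subSS subn0 ltnW.
have N2 : #|nonneighbours e v| = 2.
  by apply: (@addnI (#|T| - 3)); rewrite cN; case: #|T| hn => [|[|[|k]]] // _;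
     rewrite !subSS subn0 addn2.
have /eqP/cards2P[w1 [w2 [w12 NE]]] := N2.
have w1N : w1 \in nonneighbours e v by rewrite NE !inE eqxx.
have w2N : w2 \in nonneighbours e v by rewrite NE !inE eqxx orbT.
have d1 := degree_nonneighbour hG hn hmnh w1N.
have d2 := degree_nonneighbour hG hn hmnh w2N.
rewrite N2 in d1 d2.
have vw1 : hamiltonian_path e v w1.
  by move: w1N; rewrite inE eq_sym => /andP[]; case: hmnh => _; apply.
have [f [fI fS fe]] := neighbour_injection hG hn hmnh.1 vw1.
(* The at least two neighbours of [w1] inject into a set of size 2, so they fill it. *)
have fE : f @: [set u | e w1 u] = nonneighbours e v.
  apply/eqP; rewrite eqEcard fS N2 card_imset //.
  exact: mnh_degree_ge2.
(* The preimage [x] of [w2] is a neighbour of [w1], and it is adjacent to its successor [w2] on the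
   path. *)
move: w2N; rewrite -fE => /imsetP[x]; rewrite inE => w1x w2E.
have xw2 : e x w2 by rewrite w2E; exact: fe.
have xw1 : e x w1 by rewrite sym.
case/eqP: w12.
exact: (mnh_degree2_common_neighbour hG hmnh dmax xw1 xw2 d1 d2).
Qed.
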